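(* Let $\delta\ge0$ and let $M=(M_\omega)_{\omega\in\Omega}$ be a quantum measurement on $\mathbb C^d$. If $M$ is $\delta$-quantum-differentially-private on $\mathcal S(\mathbb C^d)$, then there exists an implementation $\tilde M$ of $M$ (a measurement with the same outcome probabilities), given by $\tilde M=(|M_\omega|)_{\omega\in\Omega}$, such that $\tilde M$ is $\alpha$-gentle on $\mathcal S(\mathbb C^d)$ for $$\alpha=\frac{e^{\delta/2}-1}{e^{\delta/2}+1}=\tanh\Big(\frac\delta4\Big).$$
   Context: $\mathcal S(\mathbb C^d)$ is the set of density matrices (positive semidefinite, trace 1) on $\mathbb C^d$. A measurement on $\mathbb C^d$ is a countable family $M=(M_\omega)_{\omega\in\Omega}$ of matrices in $\mathbb C^{d\times d}$ with $\sum_\omega M_\omega^*M_\omega=\mathbb 1$; put $E_\omega=M_\omega^*M_\omega$. Measuring $\rho$ yields a random outcome $R^M$ with $\mathbb P_\rho(R^M=\omega)=\operatorname{Tr}[\rho E_\omega]$ and, if this is positive, the post-measurement state $\rho_{M\to\omega}=M_\omega\rho M_\omega^*/\operatorname{Tr}[\rho E_\omega]$. $|A|=\sqrt{A^*A}$ is the matrix absolute value. With $\|A\|_{Tr}=\frac12\operatorname{Tr}|A|$, $M$ is $\alpha$-gentle on $\mathcal S\subseteq\mathcal S(\mathbb C^d)$ if $\|\rho-\rho_{M\to\omega}\|_{Tr}\le\alpha$ for all $\rho\in\mathcal S$ and all outcomes $\omega$ (of positive probability). $M$ is $\delta$-quantum-differentially-private on $\mathcal S$ if $\mathbb P_{\rho_1}(R^M=\omega)\le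 e^\delta\,\mathbb P_{\rho_2}(R^M=\omega)$ for all $\rho_1,\rho_2\in\mathcal S$ and $\omega\in\Omega$. *)

(* Defs.v *)
From HB Require Import structures.
From mathcomp Require Import all_boot all_order all_algebra finmap complex.
From mathcomp Require Import all_classical all_reals all_analysis.
From mathcomp Require Import summability.

Set Implicit Arguments.
Unset Strict Implicit.
Unset Printing Implicit Defensive.
Import Order.TTheory GRing.Theory Num.Theory.
Import numFieldNormedType.Exports.

Local Open Scope classical_set_scope.
Local Open Scope ring_scope.
Local Open Scope sesquilinear_scope.

(* The definitions are over an arbitrary numClosedFieldType C and are used at
   C := R[i] with R : realType. In the order of C, [x <= y] says that y - x is
   a nonnegative real; in particular [0 <= x] forces x to be real. Vectors of
   C^d are columns, and [A ^t*] is the adjoint A^*. *)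

Definition psdmx (C : numClosedFieldType) (d : nat) (A : 'M[C]_d) : Prop :=
  A \is hermsymmx /\ forall v : 'cV[C]_d, 0 <= (v ^t* *m A *m v) 0 0.

Definition density (C : numClosedFieldType) (d : nat) : set 'M[C]_d :=
  [set rho | psdmx rho /\ \tr rho = 1].
Arguments density : clear implicits.

(* Functional calculus: a normal A is P^* diag(D) P with P := spectralmx A
   unitary and D := spectral_diag A its eigenvalues. Only meaningful for
   A positive semidefinite; see sqrtmx_psd and sqrtmxK. *)
Definition sqrtmx (C : numClosedFieldType) (d : nat) (A : 'M[C]_d) : 'M[C]_d :=
  (spectralmx A) ^t* *m diag_mx (map_mx sqrtC (spectral_diag A))
    *m spectralmx A.

Definition absmx (C : numClosedFieldType) (d : nat) (A : 'M[C]_d) : 'M[C]_d :=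
  sqrtmx (A ^t* *m A).

(* Normalized with the factor 1/2. *)
Definition trnorm (C : numClosedFieldType) (d : nat) (A : 'M[C]_d) : C :=
  2^-1 * \tr (absmx A).

Definition effect (C : numClosedFieldType) (d : nat) (Omega : countType)
    (M : Omega -> 'M[C]_d) (w : Omega) : 'M[C]_d :=
  (M w) ^t* *m M w.

(* Omega may be infinite: the net of the sums over the finite subsets of Omega,
   ordered by inclusion, converges entrywise to the identity. *)
Definition measurement (C : numClosedFieldType) (d : nat) (Omega : countType)
    (M : Omega -> 'M[C]_d) : Prop :=
  (fun F : {fset Omega} => \sum_(w <- F) effect M w) @ totally
    --> (1%:M : 'M[C]_d).

Definition prob (C : numClosedFieldType) (d : nat) (Omega : countType)
    (M : Omega -> 'M[C]_d) (rho : 'M[C]_d) (w : Omega) : C :=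
  \tr (rho *m effect M w).

Definition post_state (C : numClosedFieldType) (d : nat) (Omega : countType)
    (M : Omega -> 'M[C]_d) (rho : 'M[C]_d) (w : Omega) : 'M[C]_d :=
  (prob M rho w)^-1 *: (M w *m rho *m (M w) ^t*).

Definition gentle (C : numClosedFieldType) (d : nat) (Omega : countType)
    (alpha : C) (S : set 'M[C]_d) (M : Omega -> 'M[C]_d) : Prop :=
  forall (rho : 'M[C]_d) (w : Omega), S rho -> 0 < prob M rho w ->
    trnorm (rho - post_state M rho w) <= alpha.

Definition qdp (R : realType) (d : nat) (Omega : countType) (delta : R)
    (S : set 'M[R[i]]_d) (M : Omega -> 'M[R[i]]_d) : Prop :=
  forall (rho1 rho2 : 'M[R[i]]_d) (w : Omega), S rho1 -> S rho2 ->
    prob M rho1 w <= (expR delta)%:C%C * prob M rho2 w.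

Definition implementation (C : numClosedFieldType) (d : nat)
    (Omega : countType) (M Mt : Omega -> 'M[C]_d) : Prop :=
  measurement Mt /\
  forall (rho : 'M[C]_d) (w : Omega), density C d rho ->
    prob Mt rho w = prob M rho w.

Definition tanh (R : realType) (x : R) : R :=
  (expR x - expR (- x)) / (expR x + expR (- x)).

Lemma sqrtmx_diag_ge0 (C : numClosedFieldType) (d : nat) (A : 'M[C]_d) :
  psdmx A -> A = (spectralmx A) ^t* *m diag_mx (spectral_diag A)
                   *m spectralmx A
             /\ forall i, 0 <= spectral_diag A 0 i.
Proof.
move=> [hA pA]; set P := spectralmx A; set D := spectral_diag A.
have uP : P \is unitarymx := spectral_unitarymx A.
have eA : A = P ^t* *m diag_mx D *m P.
  rewrite -invmx_unitary //.
  exact/orthomx_spectralP/hermitian_normalmx.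
split=> // i; have := pA (P ^t* *m delta_mx i 0).
rewrite trmx_mul map_mxM /= trmxCK {1}eA !mulmxA !mulmxtVK //.
have -> : (delta_mx i 0 : 'cV[C]_d) ^t* = delta_mx 0 i.
  by rewrite trmx_delta map_delta_mx.
by rewrite -rowE -colE !mxE eqxx mulr1n.
Qed.

Lemma sqrtmx_psd (C : numClosedFieldType) (d : nat) (A : 'M[C]_d) :
  psdmx A -> psdmx (sqrtmx A).
Proof.
move=> /sqrtmx_diag_ge0[_ D0]; rewrite /sqrtmx.
set P := spectralmx A; set E := map_mx sqrtC _.
have E0 i : 0 <= E 0 i by rewrite mxE sqrtC_ge0.
split.
  apply/is_hermitianmxP; rewrite expr0 scale1r !trmx_mul !map_mxM /= trmxCK.
  rewrite mulmxA tr_diag_mx map_diag_mx; congr (_ *m diag_mx _ *m _).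
  by apply/rowP => i; rewrite [RHS]mxE; apply/esym/CrealP/ger0_real.
move=> v; have -> : v ^t* *m (P ^t* *m diag_mx E *m P) *m v =
    (P *m v) ^t* *m (diag_mx E *m (P *m v)).
  by rewrite trmx_mul map_mxM /= !mulmxA.
rewrite mxE sumr_ge0 // => i _; rewrite mul_diag_mx !mxE.
by rewrite mulrCA mulr_ge0 ?sqrtC_ge0 ?D0 // mulrC mul_conjC_ge0.
Qed.

Lemma sqrtmxK (C : numClosedFieldType) (d : nat) (A : 'M[C]_d) :
  psdmx A -> sqrtmx A *m sqrtmx A = A.
Proof.
move=> /sqrtmx_diag_ge0[eA D0]; rewrite [RHS]eA /sqrtmx.
have uP := spectral_unitarymx A; rewrite !mulmxA mulmxtVK //.
rewrite -(mulmxA _ (diag_mx _) (diag_mx _)) mulmx_diag.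
congr (_ *m diag_mx _ *m _); apply/rowP => i.
by rewrite !mxE -expr2 sqrtCK.
Qed.

Lemma psdmx_adj_mul (C : numClosedFieldType) (d : nat) (A : 'M[C]_d) :
  psdmx (A ^t* *m A).
Proof.
split.
  by apply/is_hermitianmxP; rewrite expr0 scale1r trmx_mul map_mxM /= trmxCK.
move=> v; have -> : v ^t* *m (A ^t* *m A) *m v = (A *m v) ^t* *m (A *m v).
  by rewrite trmx_mul map_mxM /= !mulmxA.
by rewrite mxE sumr_ge0 // => i _; rewrite !mxE mulrC mul_conjC_ge0.
Qed.

(* Main.v *)
Require Import Defs.
From HB Require Import structures.
From mathcomp Require Import all_boot all_order all_algebra finmap complex.
From mathcomp Require Import all_classical all_reals all_analysis.
From mathcomp Require Import ring.

(** Fix an outcome w and put E = M_w^* M_w and A = |M_w| = sqrt E. Since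
    A^* A = E, replacing M_w by A changes neither the effects nor the outcome
    probabilities, so only gentleness has to be proved.

    Let rho = B B^* with B = sqrt rho. The post-measurement state is C C^* with
    C = A B / sqrt p and p = Tr[rho A^2]; both B and C are unit vectors for the
    Hilbert-Schmidt inner product, that is, they are purifications of the two
    states. Their overlap c = Tr[rho A] / sqrt p is real because A is positive:
    this is where the choice of |M_w| as implementation enters. As for vectors,
    the overlap of two purifications controls the trace distance,
    ||B B^* - C C^*||_Tr^2 <= 1 - c^2 (trnorm_sub_gram). Its proof writes the
    difference of Gram matrices as a symmetrized product of B + C and
    (B - C) / 2, turns the trace of the absolute value into an inner product
    with a polar contraction (polar_contraction), and applies Cauchy-Schwarz.

    It remains to bound c^2 = Tr[rho A]^2 / Tr[rho A^2] from below. Privacy,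
    tested on the eigenprojectors of E, says that any two eigenvalues of E have
    ratio at most exp(delta), so the eigenvalues of A lie in an interval
    [a, k a] with k = exp(delta / 2). In an eigenbasis of A, Tr[rho A] and
    Tr[rho A^2] are the first two moments of a probability distribution on this
    interval, and the Kantorovich inequality gives c^2 >= 4 k / (1 + k)^2.
    Finally 1 - 4 k / (1 + k)^2 = ((k - 1) / (k + 1))^2 = alpha^2. *)

Set Implicit Arguments.
Unset Strict Implicit.
Unset Printing Implicit Defensive.

Import Order.TTheory GRing.Theory Num.Theory.
Import numFieldNormedType.Exports.

Local Open Scope ring_scope.
Local Open Scope sesquilinear_scope.

(** * The Hilbert-Schmidt inner product *)

Definition frob (C : numClosedFieldType) (m n : nat) (X Y : 'M[C]_(m, n)) : C :=
  \tr (X *m Y ^t*).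

Lemma adjmx_mul (C : numClosedFieldType) (m n p : nat)
    (X : 'M[C]_(m, n)) (Y : 'M[C]_(n, p)) :
  (X *m Y) ^t* = Y ^t* *m X ^t*.
Proof. by rewrite trmx_mul map_mxM. Qed.

Lemma adjmxD (C : numClosedFieldType) (m n : nat) (X Y : 'M[C]_(m, n)) :
  (X + Y) ^t* = X ^t* + Y ^t*.
Proof. by rewrite linearD map_mxD. Qed.

Lemma adjmxZ (C : numClosedFieldType) (m n : nat) a (X : 'M[C]_(m, n)) :
  (a *: X) ^t* = a^* *: X ^t*.
Proof. by rewrite linearZ map_mxZ. Qed.

Lemma hermmx_adj (C : numClosedFieldType) (n : nat) (A : 'M[C]_n) :
  A \is hermsymmx -> A ^t* = A.
Proof. by move=> /is_hermitianmxP; rewrite expr0 scale1r => <-. Qed.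

Lemma frobE (C : numClosedFieldType) (m n : nat) (X Y : 'M[C]_(m, n)) :
  frob X Y = \sum_i \sum_j X i j * (Y i j)^*.
Proof.
apply: eq_bigr => i _; rewrite mxE; apply: eq_bigr => j _.
by rewrite !mxE.
Qed.

Lemma frobC (C : numClosedFieldType) (m n : nat) (X Y : 'M[C]_(m, n)) :
  frob Y X = (frob X Y)^*.
Proof.
rewrite !frobE rmorph_sum; apply: eq_bigr => i _; rewrite rmorph_sum.
by apply: eq_bigr => j _; rewrite rmorphM /= conjCK mulrC.
Qed.

Lemma frobDl (C : numClosedFieldType) (m n : nat) (X Y Z : 'M[C]_(m, n)) :
  frob (X + Y) Z = frob X Z + frob Y Z.
Proof. by rewrite /frob mulmxDl mxtraceD. Qed.

Lemma frobDr (C : numClosedFieldType) (m n : nat) (X Y Z : 'M[C]_(m, n)) :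
  frob X (Y + Z) = frob X Y + frob X Z.
Proof. by rewrite /frob adjmxD mulmxDr mxtraceD. Qed.

Lemma frobZl (C : numClosedFieldType) (m n : nat) a (X Y : 'M[C]_(m, n)) :
  frob (a *: X) Y = a * frob X Y.
Proof. by rewrite /frob -scalemxAl mxtraceZ. Qed.

Lemma frobZr (C : numClosedFieldType) (m n : nat) a (X Y : 'M[C]_(m, n)) :
  frob X (a *: Y) = a^* * frob X Y.
Proof. by rewrite /frob adjmxZ -scalemxAr mxtraceZ. Qed.

Lemma frob_ge0 (C : numClosedFieldType) (m n : nat) (X : 'M[C]_(m, n)) :
  0 <= frob X X.
Proof.
by rewrite frobE !sumr_ge0 // => i _; rewrite sumr_ge0 // => j _;
  rewrite mul_conjC_ge0.
Qed.

Lemma frob_dotmx (C : numClosedFieldType) (m n : nat) (X Y : 'M[C]_(m, n)) :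
  frob X Y = dotmx (mxvec X) (mxvec Y).
Proof.
rewrite frobE dotmxE mxE pair_bigA /=.
rewrite (reindex _ (curry_mxvec_bij _ _)) /=.
by apply: eq_bigr => -[i j] _; rewrite !mxE /= !mxvecE.
Qed.

Lemma frob_CauchySchwarz (C : numClosedFieldType) (m n : nat)
    (X Y : 'M[C]_(m, n)) :
  `|frob X Y| <= sqrtC (frob X X) * sqrtC (frob Y Y).
Proof.
rewrite !frob_dotmx.
exact: (leif_le (CauchySchwarz_sqrt (@dotmx C (m * n)) _ _)).
Qed.

(** * Trace norm and overlap *)

(** The partial isometry U of the polar decomposition A = U |A|, reduced
    to two consequences: it realizes Tr |A| as an inner product with A and does not
    increase Hilbert-Schmidt norms. It is A |A|^+, where |A|^+ is the
    pseudo-inverse of |A|, so U^* U is the projection |A|^+ |A|^2 |A|^+. *)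
Lemma polar_contraction (C : numClosedFieldType) (d : nat) (A : 'M[C]_d) :
  exists2 U : 'M[C]_d, \tr (absmx A) = frob A U
    & forall n (Y : 'M[C]_(d, n)), frob (U *m Y) (U *m Y) <= frob Y Y.
Proof.
have pG := psdmx_adj_mul A.
have [eG D0] := sqrtmx_diag_ge0 pG.
rewrite /absmx; set G := A ^t* *m A in eG D0 pG *.
set P := spectralmx G in eG *; set D := spectral_diag G in eG D0 *.
have uP : P \is unitarymx := spectral_unitarymx G.
(* As 0^-1 = 0, this is the diagonal of the pseudo-inverse. *)
pose E := map_mx (fun x => (sqrtC x)^-1) D.
have E0 i : (E 0 i)^* = E 0 i.
  by apply/CrealP/ger0_real; rewrite mxE invr_ge0 sqrtC_ge0.
(* T is the pseudo-inverse of |A|, kept abstract so that associativity does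
   not see through it. *)
have [T TE] : exists T, T = P ^t* *m diag_mx E *m P by eexists.
have Tadj : T ^t* = T.
  rewrite TE !adjmx_mul trmxCK mulmxA tr_diag_mx map_diag_mx.
  by congr (_ *m diag_mx _ *m _); apply/rowP => i; rewrite [LHS]mxE; exact: E0.
have diagP (F F' : 'rV[C]_d) : (P ^t* *m diag_mx F *m P) *m
    (P ^t* *m diag_mx F' *m P) =
    P ^t* *m diag_mx (\row_i (F 0 i * F' 0 i)) *m P.
  by rewrite !mulmxA mulmxtVK // -(mulmxA _ (diag_mx _) (diag_mx _)) mulmx_diag.
exists (A *m T).
  transitivity (\tr (T *m G)); last first.
    by rewrite /frob adjmx_mul Tadj [RHS]mxtrace_mulC mulmxA.
  rewrite [in RHS]eG TE diagP.
  rewrite /sqrtmx -/P -/D; congr (\tr (_ *m diag_mx _ *m _)).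
  apply/rowP => i; rewrite !mxE -{3}(sqrtCK (D 0 i)) expr2.
  have [->|nz] := eqVneq (sqrtC (D 0 i)) 0; first by rewrite !mulr0.
  by rewrite mulrA mulVf // mul1r.
move=> n Y.
pose Z := P *m Y.
have -> : frob (A *m T *m Y) (A *m T *m Y) =
    \tr (Z ^t* *m diag_mx (\row_i (E 0 i * (D 0 i * E 0 i))) *m Z).
  transitivity (\tr (Y ^t* *m (T *m (G *m T)) *m Y)).
    by rewrite /frob mxtrace_mulC !adjmx_mul Tadj /G !mulmxA.
  rewrite eG TE !diagP /Z adjmx_mul !mulmxA.
  congr (\tr (_ *m diag_mx _ *m _ *m _)).
  by apply/rowP => i; rewrite !mxE.
have -> : frob Y Y = \tr (Z ^t* *m Z).
  by rewrite /frob mxtrace_mulC /Z adjmx_mul mulmxA mulmxKtV.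
(* U^* U is diagonal in the eigenbasis, with entries 0 and 1. *)
rewrite /mxtrace ler_sum // => j _; rewrite -mulmxA !mxE ler_sum // => i _.
rewrite mul_diag_mx [in leLHS]mxE [X in _ * (X * _)]mxE mulrCA.
have z0 : 0 <= (Z ^t*) j i * Z i j by rewrite !mxE mulrC mul_conjC_ge0.
apply: (ler_piMl z0); rewrite !mxE -{2}(sqrtCK (D 0 i)) expr2.
have [->|nz] := eqVneq (sqrtC (D 0 i)) 0; first by rewrite !(mulr0, mul0r).
by rewrite mulfK // mulVf.
Qed.

Lemma trnorm_ge0 (C : numClosedFieldType) (d : nat) (A : 'M[C]_d) :
  0 <= trnorm A.
Proof.
rewrite mulr_ge0 ?invr_ge0 ?ler0n // sumr_ge0 // => i _.
have [_ /(_ (delta_mx i 0))] := sqrtmx_psd (psdmx_adj_mul A).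
by rewrite trmx_delta map_delta_mx -rowE -colE !mxE.
Qed.

(** With U the polar contraction of X Y^* + Y X^*, its trace norm is half the
    sum of the inner products of X with U Y and of Y with U X; Cauchy-Schwarz
    bounds each of them by ||X|| ||Y||. *)
Lemma trnorm_sym_mul (C : numClosedFieldType) (d n : nat)
    (X Y : 'M[C]_(d, n)) :
  trnorm (X *m Y ^t* + Y *m X ^t*) ^+ 2 <= frob X X * frob Y Y.
Proof.
have [U trU Ule] := polar_contraction (X *m Y ^t* + Y *m X ^t*).
have bound Z V : `|frob (Z *m V ^t*) U| <= sqrtC (frob Z Z) * sqrtC (frob V V).
  have -> : frob (Z *m V ^t*) U = frob Z (U *m V).
    by rewrite /frob adjmx_mul mulmxA.
  apply: le_trans (frob_CauchySchwarz _ _) _.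
  apply: ler_wpM2l; first by rewrite sqrtC_ge0 frob_ge0.
  by rewrite ler_sqrtC ?nnegrE ?frob_ge0 ?Ule.
rewrite -(sqrtCK (frob X X)) -(sqrtCK (frob Y Y)) -exprMn.
rewrite ler_pXn2r ?nnegrE ?trnorm_ge0 ?mulr_ge0 ?sqrtC_ge0 ?frob_ge0 //.
rewrite -(ger0_norm (trnorm_ge0 _)) /trnorm trU frobDl normrM.
rewrite gtr0_norm ?invr_gt0 ?ltr0n // mulrC ler_pdivrMr ?ltr0n //.
apply: le_trans (ler_normD _ _) _; rewrite mulr_natr mulr2n lerD ?bound //.
by rewrite [leRHS]mulrC bound.
Qed.

(** The bound of the trace distance by the overlap of purifications. The
    polarization X X^* - Y Y^* = S T^* + T S^* with S = X + Y and
    T = (X - Y) / 2 reduces it to trnorm_sym_mul: as the overlap c is real,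
    ||S||^2 = 2 + 2 c and ||T||^2 = (2 - 2 c) / 4. *)
Lemma trnorm_sub_gram (C : numClosedFieldType) (d n : nat)
    (X Y : 'M[C]_(d, n)) :
  frob X X = 1 -> frob Y Y = 1 -> frob X Y \is Num.real ->
  trnorm (X *m X ^t* - Y *m Y ^t*) ^+ 2 <= 1 - frob X Y ^+ 2.
Proof.
move=> X1 Y1 /CrealP rXY.
have h2 : (2^-1 : C)^* = 2^-1 by rewrite fmorphV rmorph_nat.
have N1 : (-1 : C)^* = -1 by rewrite rmorphN rmorph1.
pose S := X + Y; pose T := 2^-1 *: (X + -1 *: Y).
have -> : X *m X ^t* - Y *m Y ^t* = S *m T ^t* + T *m S ^t*.
  rewrite /S /T !(adjmxD, adjmxZ) h2 N1 -scalemxAl -scalemxAr -scalerDr.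
  rewrite !(mulmxDl, mulmxDr) -!scalemxAl -!scalemxAr !scaleN1r.
  rewrite [X in _ *: X](_ : _ = 2 *: (X *m X ^t* - Y *m Y ^t*)).
    by rewrite scalerA mulVf ?scale1r ?pnatr_eq0.
  rewrite scaler_nat mulr2n.
  set a := X *m X ^t*; set b := Y *m Y ^t*.
  set c := X *m Y ^t*; set e := Y *m X ^t*.
  by apply/matrixP => i j; rewrite !mxE; ring.
apply: le_trans (trnorm_sym_mul _ _) _.
rewrite le_eqVlt; apply/orP; left; apply/eqP.
rewrite /S /T !(frobDl, frobDr, frobZl, frobZr) h2 N1 X1 Y1 (frobC X Y) rXY.
by field.
Qed.

(** * The disturbance caused by a positive measurement operator *)

Lemma psdmx_sqrt (C : numClosedFieldType) (d : nat) (A : 'M[C]_d) :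
  psdmx A -> exists2 B : 'M[C]_d, B ^t* = B & B *m B = A.
Proof.
move=> pA; exists (sqrtmx A); last exact: sqrtmxK.
by have [/hermmx_adj] := sqrtmx_psd pA.
Qed.

(** Both states are Gram matrices of unit vectors, sqrt rho and
    A sqrt rho / sqrt p with A = M w, to which trnorm_sub_gram applies. *)
Lemma trnorm_post_state (C : numClosedFieldType) (d : nat)
    (Omega : countType) (M : Omega -> 'M[C]_d) (w : Omega) (rho : 'M[C]_d) :
  density C d rho -> psdmx (M w) -> 0 < prob M rho w ->
  trnorm (rho - post_state M rho w) ^+ 2 <=
    1 - \tr (rho *m M w) ^+ 2 / prob M rho w.
Proof.
move=> [pR tR] pA p0; have [/hermmx_adj hA _] := pA.
have [B hB eB] := psdmx_sqrt pR.
rewrite /post_state; set A := M w in hA pA *; set p := prob M rho w in p0 *.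
have pE : p = \tr (rho *m (A *m A)) by rewrite /p /prob /effect hA.
pose s := (sqrtC p)^-1.
have s2 : s * s = p^-1 by rewrite /s -invfM -expr2 sqrtCK.
have sC : s^* = s by apply/CrealP/ger0_real; rewrite invr_ge0 sqrtC_ge0 ltW.
have trE : frob B (s *: (A *m B)) = s * \tr (rho *m A).
  by rewrite frobZr sC /frob adjmx_mul hA hB mulmxA eB.
have rt : \tr (rho *m A) \is Num.real.
  have [S hS eS] := psdmx_sqrt pA.
  (* Tr[rho A] = ||A^(1/2) B||^2. *)
  have -> : \tr (rho *m A) = frob (S *m B) (S *m B).
    rewrite /frob adjmx_mul hB hS [RHS]mxtrace_mulC mulmxA -(mulmxA B).
    by rewrite eS -mulmxA [RHS]mxtrace_mulC -mulmxA eB [LHS]mxtrace_mulC.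
  by rewrite ger0_real // frob_ge0.
have -> : rho - p^-1 *: (A *m rho *m A ^t*) =
    B *m B ^t* - (s *: (A *m B)) *m (s *: (A *m B)) ^t*.
  rewrite hB eB adjmxZ sC -scalemxAl -scalemxAr scalerA s2 adjmx_mul hB.
  by rewrite !mulmxA -(mulmxA A B B) eB.
apply: le_trans (trnorm_sub_gram _ _ _) _.
- by rewrite /frob hB eB.
- rewrite frobZl frobZr sC mulrA s2 /frob adjmx_mul hA hB mulmxA -(mulmxA A) eB.
  by rewrite mxtrace_mulC mulmxA mxtrace_mulC -pE mulVf // gt_eqF.
- by rewrite trE realM // CrealE sC.
by rewrite trE exprMn expr2 s2 mulrC.
Qed.

(** * Lower bound on the overlap *)

(** Averaging (x_i - a) (b - x_i) >= 0 gives q + a b <= (a + b) t for the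
    moments t and q of order 1 and 2; the claim then follows from
    4 (a b) q <= (q + a b)^2. *)
Lemma Kantorovich (C : numClosedFieldType) (I : finType) (w x : I -> C)
    (a b : C) :
  0 <= a -> 0 <= b -> (forall i, 0 <= w i) -> \sum_i w i = 1 ->
  (forall i, a <= x i <= b) ->
  4 * (a * b) * (\sum_i w i * x i ^+ 2) <=
    (a + b) ^+ 2 * (\sum_i w i * x i) ^+ 2.
Proof.
move=> a0 b0 w0 w1 xab; set q := \sum_i _; set t := \sum_i (_ * x _).
have x0 i : 0 <= x i by case/andP: (xab i) => + _; apply: le_trans.
have q0 : 0 <= q by apply: sumr_ge0 => i _; rewrite mulr_ge0 ?exprn_ge0.
have t0 : 0 <= t by apply: sumr_ge0 => i _; rewrite mulr_ge0.
have qt : q + a * b <= (a + b) * t.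
  rewrite -subr_ge0.
  have -> : (a + b) * t - (q + a * b) =
      \sum_i w i * ((x i - a) * (b - x i)).
    have -> : q + a * b = q + a * b * \sum_i w i by rewrite w1 mulr1.
    rewrite opprD !mulr_sumr -!sumrN -!big_split /=.
    by apply: eq_bigr => i _; ring.
  apply: sumr_ge0 => i _; have /andP[ax xb] := xab i.
  by rewrite !mulr_ge0 ?subr_ge0.
have ab0 : 0 <= a * b by rewrite mulr_ge0.
apply: le_trans (_ : (q + a * b) ^+ 2 <= _).
  rewrite -subr_ge0.
  have -> : (q + a * b) ^+ 2 - 4 * (a * b) * q = (q - a * b) ^+ 2 by ring.
  by rewrite real_exprn_even_ge0 // realB // ger0_real.
by rewrite -exprMn lerXn2r // nnegrE ?addr_ge0 ?mulr_ge0 ?addr_ge0.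
Qed.

(** The projector on the i-th eigenvector of E, written as a Gram matrix: the
    state on which the effect E has its i-th eigenvalue as probability. *)
Lemma spectral_projector_density (C : numClosedFieldType) (d : nat)
    (E : 'M[C]_d) (i : 'I_d) :
  psdmx E ->
  let X := delta_mx i i *m spectralmx E in
  density C d (X ^t* *m X) /\ \tr (X ^t* *m X *m E) = spectral_diag E 0 i.
Proof.
move=> /sqrtmx_diag_ge0[eE _]; set P := spectralmx E in eE *.
have /unitarymxP PP : P \is unitarymx := spectral_unitarymx E.
have delta_adj : (delta_mx i i : 'M[C]_d) ^t* = delta_mx i i.
  by rewrite trmx_delta map_delta_mx.
move=> X; have XP : X *m P ^t* = delta_mx i i by rewrite -mulmxA PP mulmx1.
split; first split; first exact: psdmx_adj_mul.
  rewrite mxtrace_mulC {2}/X adjmx_mul mulmxA XP delta_adj mul_delta_mx.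
  rewrite /mxtrace (bigD1 i) //= big1 ?addr0 ?mxE ?eqxx // => j ji.
  by rewrite mxE (negbTE ji).
have PX : spectralmx E *m X ^t* = delta_mx i i.
  by rewrite -[LHS]trmxCK adjmx_mul trmxCK XP delta_adj.
rewrite -mulmxA mxtrace_mulC {1}eE !mulmxA XP -mulmxA -!mulmxA PX mxtrace_mulC.
rewrite -!mulmxA mul_delta_mx /mxtrace (bigD1 i) //= big1 ?addr0 => [|j ji].
  by rewrite mul_diag_mx !mxE !eqxx mulr1.
by rewrite mul_diag_mx !mxE (negbTE ji) mulr0.
Qed.

(** If the eigenvalues of E have pairwise ratios at most k^2, those of sqrt E
    lie between the least one, m, and k m. Weighted by the diagonal of rho in an
    eigenbasis, they satisfy the Kantorovich inequality, in which m cancels. *)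
Lemma sqrtmx_overlap (C : numClosedFieldType) (d : nat) (E rho : 'M[C]_d)
    (k : C) :
  density C d rho -> psdmx E -> 0 < k ->
  (forall i j, spectral_diag E 0 i <= k ^+ 2 * spectral_diag E 0 j) ->
  0 < \tr (rho *m E) ->
  4 * k / (1 + k) ^+ 2 <= \tr (rho *m sqrtmx E) ^+ 2 / \tr (rho *m E).
Proof.
move=> [pR tR] pE k0 ratio q0.
have [eE D0] := sqrtmx_diag_ge0 pE; set D := spectral_diag E in ratio eE D0.
set P := spectralmx E in eE; have uP : P \is unitarymx := spectral_unitarymx E.
pose w i := (P *m rho *m P ^t*) i i.
have w0 i : 0 <= w i.
  have [_ /(_ (P ^t* *m delta_mx i 0))] := pR.
  rewrite adjmx_mul trmxCK.
  have -> : (delta_mx i 0 : 'cV[C]_d) ^t* = delta_mx 0 i.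
    by rewrite trmx_delta map_delta_mx.
  by rewrite !mulmxA -colE -!mulmxA -rowE mulmxA [leRHS]mxE [leRHS]mxE.
have trw (F : 'rV[C]_d) :
    \tr (rho *m (P ^t* *m diag_mx F *m P)) = \sum_i w i * F 0 i.
  rewrite !mulmxA mxtrace_mulC !mulmxA; apply: eq_bigr => i _.
  by rewrite mul_mx_diag mxE.
have w1 : \sum_i w i = 1.
  by rewrite -tR -/(\tr _) mxtrace_mulC mulmxA -(invmx_unitary uP) mulVmx
    ?mul1mx // unitarymx_unit.
pose x i := sqrtC (D 0 i).
have x0 i : 0 <= x i by rewrite sqrtC_ge0.
have xx i : x i ^+ 2 = D 0 i by rewrite sqrtCK.
have trE : \tr (rho *m E) = \sum_i w i * x i ^+ 2.
  by rewrite [in LHS]eE trw; apply: eq_bigr => i _; rewrite xx.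
have trS : \tr (rho *m sqrtmx E) = \sum_i w i * x i.
  by rewrite /sqrtmx trw; apply: eq_bigr => i _; rewrite mxE.
have xk i j : x i <= k * x j.
  rewrite -(ler_pXn2r (n := 2)) ?nnegrE ?mulr_ge0 // ?(ltW k0) //.
  by rewrite exprMn !xx.
(* Some eigenvalue is positive, as otherwise Tr[rho E] = 0; then all are. *)
have [i0 xi0] : exists i0, 0 < x i0.
  apply/existsP; apply: contraTT q0 => /existsPn xn; rewrite trE big1 ?ltxx //.
  move=> i _; have := xn i; rewrite lt0r x0 andbT negbK => /eqP ->.
  by rewrite expr0n mulr0.
have real_x : {in predT, forall i, x i \is Num.real}.
  by move=> i _; apply: ger0_real.
case: (real_arg_minP (erefl : predT i0) real_x) => m _ mP.
have xm : 0 < x m.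
  by rewrite -(pmulr_rgt0 _ k0); apply: lt_le_trans (xk i0 m).
have K : 4 * (x m * (k * x m)) * \tr (rho *m E) <=
    (x m + k * x m) ^+ 2 * \tr (rho *m sqrtmx E) ^+ 2.
  rewrite trE trS; apply: Kantorovich => // [|i]; first by rewrite mulr_ge0 ?ltW.
  by rewrite mP ?xk.
have k1 : 0 < (1 + k) ^+ 2 by rewrite exprn_gt0 ?addr_gt0.
rewrite ler_pdivlMr // mulrAC ler_pdivrMr // -(ler_pM2l (exprn_gt0 2 xm)).
by apply: le_trans (le_trans K _); rewrite le_eqVlt; apply/orP; left;
  apply/eqP; ring.
Qed.

(** * Absolute values of measurement operators *)

Lemma absmx_adj (C : numClosedFieldType) (d : nat) (A : 'M[C]_d) :
  (absmx A) ^t* = absmx A.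
Proof. by have [/hermmx_adj] := sqrtmx_psd (psdmx_adj_mul A). Qed.

Lemma effect_absmx (C : numClosedFieldType) (d : nat) (Omega : countType)
    (M : Omega -> 'M[C]_d) :
  effect (fun w => absmx (M w)) = effect M.
Proof.
apply/funext => w; rewrite /effect absmx_adj; exact/sqrtmxK/psdmx_adj_mul.
Qed.

Unset Implicit Arguments.

Theorem corollary4 (R : realType) (d : nat) (Omega : countType) (delta : R)
    (M : Omega -> 'M[R[i]]_d)
    (hdelta : 0 <= delta) (hM : measurement M)
    (hqdp : qdp delta (density R[i] d) M) :
  let alpha : R := (expR (delta / 2) - 1) / (expR (delta / 2) + 1) in
  alpha = tanh (delta / 4) /\
  exists Mt : Omega -> 'M[R[i]]_d,
    [/\ forall w : Omega, Mt w = absmx (M w),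
        implementation M Mt
      & gentle alpha%:C%C (density R[i] d) Mt].
Proof.
move=> alpha; split.
  rewrite /alpha /tanh expRN.
  have -> : delta / 2 = delta / 4 + delta / 4 by field.
  rewrite expRD; have := expR_gt0 (delta / 4); move: (expR _) => x x0.
  have xn : x != 0 by rewrite gt_eqF.
  have xn1 : x * x + 1 != 0 by rewrite gt_eqF // addr_gt0 ?mulr_gt0.
  by field; rewrite xn xn1.
exists (fun w => absmx (M w)); split=> //.
  split; first by rewrite /measurement effect_absmx.
  by move=> rho w _; rewrite /prob effect_absmx.
move=> rho w dR p0.
have pA : psdmx (absmx (M w)) := sqrtmx_psd (psdmx_adj_mul (M w)).
have := trnorm_post_state dR pA p0.
move: (trnorm_ge0 (rho - post_state (fun w => absmx (M w)) rho w)) p0.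
move: (trnorm _) => T T0; rewrite /prob effect_absmx => p0 leT.
pose k : R[i] := (expR (delta / 2))%:C%C.
have k0 : 0 < k by rewrite ltcR expR_gt0.
have ratio i j : spectral_diag (effect M w) 0 i <=
    k ^+ 2 * spectral_diag (effect M w) 0 j.
  have [di <-] := spectral_projector_density i (psdmx_adj_mul (M w)).
  have [dj <-] := spectral_projector_density j (psdmx_adj_mul (M w)).
  have -> : k ^+ 2 = (expR delta)%:C%C.
    by rewrite -rmorphXn /= -expRM_natl mulrC -mulr_natr divfK ?pnatr_eq0.
  exact: hqdp.
have alphaE : alpha%:C%C = (k - 1) / (k + 1).
  by rewrite /alpha rmorphM fmorphV rmorphB rmorphD rmorph1.
have alpha0 : 0 <= alpha%:C%C :> R[i].
  rewrite lecR; apply: divr_ge0; last by rewrite addr_ge0 ?expR_ge0.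
  by rewrite subr_ge0 -expR0 ler_expR divr_ge0.
rewrite -(ler_pXn2r (n := 2)) ?nnegrE //; apply: le_trans leT _.
have k1 : 1 + k != 0 by rewrite gt_eqF ?addr_gt0.
have -> : alpha%:C%C ^+ 2 = 1 - 4 * k / (1 + k) ^+ 2 :> R[i].
  by rewrite alphaE (addrC k 1); field.
by rewrite lerD2l lerN2 (sqrtmx_overlap dR (psdmx_adj_mul (M w)) k0 ratio p0).
Qed.
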